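(* Let $\mathcal{G}$ be a noncompact metric graph with nonempty compact core $\mathcal{K}$ of total length $\ell$, let $p\in[4,6)$ and $\mu>0$. Assume that $$\ell\,\mu^{\frac{p-2}{6-p}}<\mathcal{C}_\infty^{-p}\,\mathcal{C}_p^{\frac{4-p}{6-p}}.$$ Then there are no bound states of mass $\mu$ (for the NLS equation on $\mathcal{G}$ with nonlinearity localized on $\mathcal{K}$ and Kirchhoff conditions) with $\lambda\ge 0$. In particular, there are no bound states of mass $\mu$ supported on $\mathcal{G}$.
   Context: Metric graphs. A metric graph $\mathcal{G}$ is a connected multigraph (multiple edges and self-loops allowed) with finitely many edges; each edge $e$ is identified either with a bounded interval $I_e=[0,\ell_e]$, $\ell_e>0$ (bounded edge, coordinate $x_e$ with arbitrary orientation), or with $I_e=[0,+\infty)$ (half-line, attached to the graph at its vertex $x_e=0$; the point at infinity is not a vertex), the edges being joined at their endpoints, the vertices. $\mathcal{G}$ is noncompact if and only if it contains at least one half-line. The compact core $\mathcal{K}$ is the metric subgraph consisting of all bounded edges, and $\ell=\sum_{e\in\mathcal{K}}\ell_e$. Function spaces. A function $u:\mathcal{G}\to\mathbb{C}$ is a family $\{u_e\}$ with $u_e:I_e\to\mathbb{C}$. $\|u\|_{L^p(\mathcal{G})}^p=\sum_e\|u_e\|_{L^p(I_e)}^p$. $H^1(\mathcal{G})$ is the space of continuous $u:\mathcal{G}\to\mathbb{C}$ (components agree at common vertices) with $u_e\in H^1(I_e;\mathbb{C})$ for every edge $e$, with norm $\|u\|_{H^1}^2=\|u'\|_{L^2}^2+\|u\|_{L^2}^2$.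 For $\mu>0$, $H^1_\mu(\mathcal{G})=\{u\in H^1(\mathcal{G}):\|u\|_{L^2(\mathcal{G})}^2=\mu\}$. Bound states. Let $\kappa:\mathcal{G}\to\{0,1\}$ be the characteristic function of $\mathcal{K}$ and $p>2$. A bound state of mass $\mu$ is a function $u\in H^1_\mu(\mathcal{G})$ for which there is $\lambda\in\mathbb{R}$ (the Lagrange multiplier of $u$) such that $u_e''+\kappa(x)|u_e|^{p-2}u_e=\lambda u_e$ on every edge $e$, and $\sum_{e\succ \mathrm{v}}\frac{du_e}{dx_e}(\mathrm{v})=0$ for every vertex $\mathrm{v}\in\mathcal{K}$ (Kirchhoff condition), where the sum is over all edges incident at $\mathrm{v}$ and $\frac{du_e}{dx_e}(\mathrm{v})$ is $u_e'(0)$ or $-u_e'(\ell_e)$ according to whether $x_e$ equals $0$ or $\ell_e$ at $\mathrm{v}$. A bound state is supported on $\mathcal{K}$ if it vanishes identically on all half-lines of $\mathcal{G}$; otherwise it is supported on $\mathcal{G}$. Constants. For $p\in[2,\infty)$, $\mathcal{C}_p>0$ and $\mathcal{C}_\infty>0$ denote universal (graph-independent) Gagliardo–Nirenberg constants, i.e. such that for every noncompact metric graph $\mathcal{G}$ and all $u\in H^1(\mathcal{G})$: $\|u\|_{L^p(\mathcal{G})}^p\le\mathcal{C}_p\|u\|_{L^2(\mathcal{G})}^{\frac p2+1}\|u'\|_{L^2(\mathcal{G})}^{\frac p2-1}$ and $\|u\|_{L^\infty(\mathcal{G})}\le\mathcal{C}_\infty\|u\|_{L^2(\mathcal{G})}^{1/2}\|u'\|_{L^2(\mathcal{G})}^{1/2}$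 (one may take the constants of the half-line $[0,+\infty)$). *)

(* Defs.v *)
From HB Require Import structures.
From mathcomp Require Export all_boot all_order all_algebra.
From mathcomp Require Export all_classical all_reals all_analysis.
From mathcomp Require Export complex.

Set Implicit Arguments.
Unset Strict Implicit.
Unset Printing Implicit Defensive.

Export Order.TTheory GRing.Theory Num.Theory.
Export numFieldNormedType.Exports.

Local Open Scope classical_set_scope.
Local Open Scope ring_scope.

(* Bounded edges and half-lines are kept in two separate finite types. Loops
   and parallel edges are allowed. A half-line has a single vertex, so
   connectedness only involves the bounded edges. *)
Record metric_graph (R : realType) := MetricGraph {
  vertex : finType;
  bedge : finType;
  halfline : finType;
  elen : bedge -> R;
  esrc : bedge -> vertex;   (* the vertex at [x_e = 0] *)
  etgt : bedge -> vertex;   (* the vertex at [x_e = elen e] *)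
  hroot : halfline -> vertex;
  elen_gt0 : forall e, 0 < elen e;
  graph_connected : forall v w : vertex,
    connect [rel a b | [exists e, ((esrc e == a) && (etgt e == b))
                               || ((esrc e == b) && (etgt e == a))]] v w
}.

Definition edge (R : realType) (G : metric_graph R) : finType :=
  (bedge G + halfline G)%type.

Definition edge_itv (R : realType) (G : metric_graph R) (e : edge G) : set R :=
  match e with
  | inl b => `[0, elen b]
  | inr _ => `[0, +oo[
  end.

Definition noncompact (R : realType) (G : metric_graph R) : Prop :=
  (0 < #|halfline G|)%N.

Definition core_nonempty (R : realType) (G : metric_graph R) : Prop :=
  (0 < #|bedge G|)%N.

Definition core_length (R : realType) (G : metric_graph R) : R :=
  \sum_(b : bedge G) elen b.

Definition in_core (R : realType) (G : metric_graph R) (v : vertex G) : Prop :=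
  exists b : bedge G, esrc b = v \/ etgt b = v.

(* Only the values of the [e]-component on [edge_itv e] are meaningful. *)
Definition graph_fun (R : realType) (G : metric_graph R) : Type :=
  edge G -> R -> R[i]^o.

Definition edge_norm (R : realType) (G : metric_graph R) (q : \bar R)
    (u : graph_fun G) (e : edge G) : \bar R :=
  'N[lebesgue_measure]_q
    [(fun x : R => (Normc.normc (u e x))%:E) \_ (edge_itv e)]%E.

Definition Lp_norm (R : realType) (G : metric_graph R) (p : R)
    (u : graph_fun G) : \bar R :=
  ((\sum_(e : edge G) edge_norm p%:E u e `^ p) `^ p^-1)%E.

Definition Linfty_norm (R : realType) (G : metric_graph R)
    (u : graph_fun G) : \bar R :=
  (\big[maxe/0]_(e : edge G) edge_norm +oo u e)%E.

Definition in_L2 (R : realType) (G : metric_graph R) (u : graph_fun G) : Prop :=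
  forall e : edge G,
    [/\ measurable_fun (edge_itv e) (fun x => complex.Re (u e x)),
        measurable_fun (edge_itv e) (fun x => complex.Im (u e x)) &
        (edge_norm 2%:E u e < +oo)%E].

(* Smooth functions with compact support contained in the interior of [I]. *)
Definition test_function (R : realType) (I : set R) (phi : R -> R) : Prop :=
  (forall (n : nat) (x : R), derivable (phi^`(n))%classic x 1) /\
  exists K : set R, [/\ compact K, K `<=` I° & forall x, ~ K x -> phi x = 0].

Definition weak_derivative (R : realType) (I : set R) (f g : R -> R) : Prop :=
  forall phi : R -> R, test_function I phi ->
    \int[lebesgue_measure]_(x in I) (f x * (phi^`())%classic x) =
    - \int[lebesgue_measure]_(x in I) (g x * phi x).

(* [u] belongs to H^1(G) and [du] is its derivative, i.e. on every edge [du] is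
   the square integrable weak derivative of [u]. Integrals of complex functions
   are taken componentwise. *)
Record H1_with_derivative (R : realType) (G : metric_graph R)
    (u du : graph_fun G) : Prop := {
  H1_edge_continuous : forall e : edge G, {within edge_itv e, continuous (u e)};
  H1_vertex_continuous : exists uv : vertex G -> R[i],
    (forall b : bedge G,
       u (inl b) 0 = uv (esrc b) /\ u (inl b) (elen b) = uv (etgt b)) /\
    (forall h : halfline G, u (inr h) 0 = uv (hroot h));
  H1_fun_L2 : in_L2 u;
  H1_derivative_L2 : in_L2 du;
  H1_weak_derivative : forall e : edge G,
    weak_derivative (edge_itv e)
      (fun x => complex.Re (u e x)) (fun x => complex.Re (du e x)) /\
    weak_derivative (edge_itv e)
      (fun x => complex.Im (u e x)) (fun x => complex.Im (du e x))
}.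

Definition in_H1 (R : realType) (G : metric_graph R) (u : graph_fun G) : Prop :=
  exists du : graph_fun G, H1_with_derivative u du.

Definition in_H1_mass (R : realType) (G : metric_graph R) (mu : R)
    (u : graph_fun G) : Prop :=
  in_H1 u /\ (Lp_norm 2 u `^ 2 = mu%:E)%E.

(* Derivative of a complex function of a real variable relative to [I]; this is
   the one-sided derivative when [x] is an endpoint of the interval [I]. *)
Definition derivative_within (R : realType) (I : set R) (f : R -> R[i]^o)
    (x : R) (d : R[i]^o) : Prop :=
  (f y - f x) / ((y - x)%:C)%C @[y --> within I x^'] --> d.

Definition kappa (R : realType) (G : metric_graph R) (e : edge G) : R :=
  if e is inl _ then 1 else 0.

Definition kirchhoff_sum (R : realType) (G : metric_graph R)
    (du : graph_fun G) (v : vertex G) : R[i] :=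
  \sum_(b : bedge G | esrc b == v) du (inl b) 0
  + \sum_(b : bedge G | etgt b == v) - du (inl b) (elen b)
  + \sum_(h : halfline G | hroot h == v) du (inr h) 0.

(* The equation is required in the open edges, while the first derivative
   exists up to the endpoints, where the Kirchhoff condition uses it. *)
Definition bound_state_with_multiplier (R : realType) (G : metric_graph R)
    (p mu lambda : R) (u : graph_fun G) : Prop :=
  in_H1_mass mu u /\
  exists du : graph_fun G,
    [/\ forall (e : edge G) (x : R), edge_itv e x ->
          derivative_within (edge_itv e) (u e) x (du e x),
        forall (e : edge G) (x : R), (edge_itv e)° x ->
          exists d2u : R[i]^o,
            derivative_within (edge_itv e) (du e) x d2u /\
            d2u + ((kappa e * Normc.normc (u e x) `^ (p - 2))%:C)%C * u e x
              = (lambda%:C)%C * u e x &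
        forall v : vertex G, in_core v -> kirchhoff_sum du v = 0].

Definition bound_state (R : realType) (G : metric_graph R) (p mu : R)
    (u : graph_fun G) : Prop :=
  exists lambda : R, bound_state_with_multiplier p mu lambda u.

Definition supported_on_core (R : realType) (G : metric_graph R)
    (u : graph_fun G) : Prop :=
  forall (h : halfline G) (x : R), edge_itv (inr h : edge G) x ->
    u (inr h) x = 0.

Definition supported_on_graph (R : realType) (G : metric_graph R)
    (u : graph_fun G) : Prop := ~ supported_on_core u.

Definition GN_constant (R : realType) (p C : R) : Prop :=
  0 < C /\
  forall (G : metric_graph R) (u du : graph_fun G),
    noncompact G -> H1_with_derivative u du ->
    (Lp_norm p u `^ p <=
     C%:E * Lp_norm 2 u `^ (p / 2 + 1) * Lp_norm 2 du `^ (p / 2 - 1))%E.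

Definition GN_constant_infty (R : realType) (C : R) : Prop :=
  0 < C /\
  forall (G : metric_graph R) (u du : graph_fun G),
    noncompact G -> H1_with_derivative u du ->
    (Linfty_norm u <= C%:E * Lp_norm 2 u `^ 2^-1 * Lp_norm 2 du `^ 2^-1)%E.

(* Main.v *)
Require Import Defs.
From mathcomp Require Import measurable_realfun ess_sup_inf ring lra.

(** Let [u] be a bound state with multiplier [lambda >= 0]. Multiplying the equation
    by the conjugate of [u], integrating over the graph and using the Kirchhoff
    conditions gives
      [|u'|_2^2 + lambda |u|_2^2 = int_K |u|^p],
    hence [|u'|_2^2 <= int_K |u|^p] ([gradient_le_core_power]). The right-hand side
    has two upper bounds: the Gagliardo-Nirenberg inequality in [L^p]
    ([core_power_le_Lp]), which bounds [|u'|_2] from above because [p < 6], and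
    [l |u|_oo^p] followed by the inequality in [L^oo] ([core_power_le_Linfty]),
    which bounds [|u'|_2] from below when [p > 4]. Together they force
    [l mu^((p-2)/(6-p)) >= Cinfty^-p Cp^((4-p)/(6-p))] ([mass_threshold]), unless
    [u' = 0]; but then [u = 0] by the [L^oo] inequality ([Linfty_le0_mass0]).

    If [lambda < 0], the equation on a half-line is that of an oscillator, which
    has no nonzero square integrable solution; so [u] vanishes on every half-line
    ([negative_multiplier_supported_on_core]), and a bound state supported on the
    whole graph has [lambda >= 0].

    The half-lines are treated without solving the equation. For the real and
    imaginary parts [f] of [u], the product [f f'] is nondecreasing there when
    [lambda >= 0], and integrability of [f^2] then makes it nonpositive
    ([halfline_mul_le0]); this yields at once that [u'] is in [L^2], and the energy
    estimate as an inequality ([halfline_energy]), which suffices here.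

    Two facts connect the pointwise formulation of the equation with the weak
    one of the function space: the derivative is continuous up to the vertices
    ([derivative_within_continuous]), and it is a weak derivative
    ([bound_state_H1]). *)

Set Implicit Arguments.
Unset Strict Implicit.
Unset Printing Implicit Defensive.

Local Open Scope classical_set_scope.
Local Open Scope ring_scope.

(** * Calculus on segments *)

(** The real counterpart of [derivative_within]; real and imaginary parts of a
    complex derivative are derivatives in this sense. *)
Definition real_derivative_within (R : realType) (I : set R) (f : R -> R)
    (x d : R) : Prop :=
  (f y - f x) / (y - x) @[y --> within I x^'] --> d.

Lemma is_derive_interior (R : realType) (I : set R) (f : R -> R) (x d : R) :
  I° x -> real_derivative_within I f x d -> is_derive x 1 f d.
Proof.
move=> Ix fd.
have fd' : (h^-1 *: ((f \o shift x) (h *: (1 : R)) - f x)) @[h --> 0^'] --> d.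
  apply/cvgrPdist_lt => e e0.
  move/cvgrPdist_lt : fd => /(_ _ e0).
  rewrite near_withinE /dnbhs near_withinE => fd.
  have {fd} : \forall y \near x, y != x -> `|d - (f y - f x) / (y - x)| < e.
    by near=> y => yx; apply: (near fd y) => //; near: y; exact: Ix.
  rewrite (near_shift 0) => fd.
  rewrite near_withinE; near=> h => h0.
  have : h + (x - 0) != x -> `|d - (f (h + (x - 0)) - f x) / (h + (x - 0) - x)| < e.
    by apply: (near fd h).
  by rewrite subr0 addrK mulrC /GRing.scale/= mulr1; apply; rewrite -subr_eq0 addrK.
apply: DeriveDef; first by apply/cvg_ex; exists d.
by rewrite /derive; apply/cvg_lim.
Unshelve. all: by end_near. Qed.

Lemma is_derive_at_continuous (R : realType) (f : R -> R) (x d : R) :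
  is_derive x 1 f d -> {for x, continuous f}.
Proof.
by move=> [fd _]; apply/differentiable_continuous; rewrite -derivable1_diffP.
Qed.

Lemma Rintegral_FTC2 (R : realType) (F f : R -> R) (a b : R) : a <= b ->
  {within `[a, b], continuous F} -> {within `[a, b], continuous f} ->
  (forall x, a < x < b -> is_derive x 1 F (f x)) ->
  \int[lebesgue_measure]_(x in `[a, b]) f x = F b - F a.
Proof.
rewrite le_eqVlt => /predU1P[->|ab] cF cf dF.
  by rewrite set_itv1 /Rintegral integral_set1 subrr.
have [F1 F2 F3] := (continuous_within_itvP _ ab).1 cF.
rewrite /Rintegral (continuous_FTC2 ab cf (F := F)) //.
- by split => // x; rewrite in_itv/= => /dF[].
- by move=> x; rewrite in_itv/= derive1E => /dF[].
Qed.

Lemma near_dist_lt (R : realType) (c e : R) : 0 < e ->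
  \forall y \near c, `|c - y| < e.
Proof. by move=> e0; exists e. Qed.

(** If [f' = g] on a segment, endpoints included, and [g'] is bounded inside, then
    [g] has no jump at the endpoints: by the mean value theorem the difference
    quotient of [f] between [c] and [y] is a value of [g] at some point between
    them, and [g] is Lipschitz inside, so [g y] differs from that quotient by at
    most [C |y - c|], while the quotient tends to [g c]. *)
Lemma derivative_within_continuous (R : realType) (a b C : R) (f g dg : R -> R) :
  a < b ->
  {within `[a, b], continuous f} ->
  (forall x, `[a, b]%classic x -> real_derivative_within `[a, b] f x (g x)) ->
  (forall x, a < x < b -> is_derive x 1 g (dg x)) ->
  (forall x, a < x < b -> `|dg x| <= C) ->
  {within `[a, b], continuous g}.
Proof.
move=> ab cf df ddg dgC.
have df' x : a < x < b -> is_derive x 1 f (g x).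
  move=> axb; apply: (@is_derive_interior _ `[a, b]).
    by rewrite interior_itv_bnd /= in_itv.
  by apply: df; rewrite /= in_itv/=; case/andP: axb => /ltW -> /ltW ->.
have lip x y : a < x < b -> a < y < b -> `|g x - g y| <= C * `|x - y|.
  wlog xy : x y / x <= y.
    move=> H hx hy; have [/H|/ltW/H] := leP x y; first exact.
    by rewrite distrC (distrC y); apply.
  move=> /andP[ax xb] /andP[ay yb].
  have gc : {within `[x, y], continuous g}.
    apply: continuous_in_subspaceT => z; rewrite inE/= in_itv/= => /andP[xz zy].
    apply: is_derive_at_continuous; apply: ddg.
    by rewrite (lt_le_trans ax xz) (le_lt_trans zy yb).
  have gd z : z \in `]x, y[ -> is_derive z 1 g (dg z).
    rewrite in_itv/= => /andP[xz zy]; apply: ddg.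
    by rewrite (lt_trans ax xz) (lt_trans zy yb).
  have [z] := MVT_segment xy gd gc.
  rewrite in_itv/= => /andP[xz zy].
  rewrite distrC (distrC x) => ->; rewrite normrM ler_wpM2r//; apply: dgC.
  by rewrite (lt_le_trans ax xz) (le_lt_trans zy yb).
have C0 : 0 <= C.
  have h : a < (a + b) / 2 < b by apply/andP; split; lra.
  exact: le_trans (dgC _ h).
have key c y : `[a, b]%classic c -> a < y < b -> y != c ->
    `|(f y - f c) / (y - c) - g y| <= C * `|y - c|.
  rewrite /= in_itv/= => /andP[ac cb] /andP[ay yb] yc.
  have [z [z1 z2 z3]] : exists z, [/\ a < z < b, `|z - y| <= `|y - c| &
      (f y - f c) / (y - c) = g z].
    have [cy|cy|e] := ltgtP c y; last by rewrite e eqxx in yc.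
    - have [||z] := @MVT R f g c y cy.
      + move=> z; rewrite in_itv/= => /andP[z1 z2]; apply: df'.
        by rewrite (le_lt_trans ac z1) (lt_trans z2 yb).
      + apply: continuous_subspaceW cf => z /=; rewrite !in_itv/= => /andP[z1 z2].
        by rewrite (le_trans ac z1) (le_trans z2 (ltW yb)).
      rewrite in_itv/= => /andP[z1 z2] ->; exists z; split.
      + by rewrite (le_lt_trans ac z1) (lt_trans z2 yb).
      + by rewrite ltr0_norm ?subr_lt0// gtr0_norm ?subr_gt0//; lra.
      + by rewrite mulfK// subr_eq0.
    - have [||z] := @MVT R f g y c cy.
      + move=> z; rewrite in_itv/= => /andP[z1 z2]; apply: df'.
        by rewrite (lt_le_trans z2 cb) (lt_trans ay z1).
      + apply: continuous_subspaceW cf => z /=; rewrite !in_itv/= => /andP[z1 z2].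
        by rewrite (le_trans z2 cb) (le_trans (ltW ay) z1).
      rewrite in_itv/= => /andP[z1 z2] e; exists z; split.
      + by rewrite (lt_le_trans z2 cb) (lt_trans ay z1).
      + by rewrite gtr0_norm ?subr_gt0// ltr0_norm ?subr_lt0//; lra.
      + by rewrite -[f y - f c]opprB e -mulrN opprB mulfK// subr_eq0.
  rewrite z3; apply: le_trans (lip _ _ z1 _) _; first by rewrite ay yb.
  exact: ler_wpM2l.
apply/subspace_continuousP => c abc.
have [/andP acb|cab] := boolP (a < c < b).
  apply: cvg_within_filter; apply: is_derive_at_continuous; exact/ddg/andP.
have /cvgrPdist_lt dfc := df _ abc.
apply/cvgrPdist_lt => e e0.
have e20 : 0 < e / 2 by rewrite divr_gt0.
have C1 : 0 < C + 1 by lra.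
have dfc' : \forall y \near c, y != c -> `[a, b]%classic y ->
    `|g c - (f y - f c) / (y - c)| < e / 2 := dfc _ e20.
rewrite near_withinE; near=> y => aby; rewrite /from_subspace.
have [->|yc] := eqVneq y c; first by rewrite subrr normr0.
have ycab : `|c - y| < b - a.
  by near: y; apply: near_dist_lt; rewrite subr_gt0.
(* c is an endpoint here, and y is too close to c to be the other one *)
have ayb : a < y < b.
  move: abc aby cab yc ycab; rewrite /= !in_itv/=.
  move=> /andP[c1 c2] /andP[y1 y2] cab yc; rewrite ltr_norml => /andP[y3 y4].
  rewrite !lt_neqAle y1 y2 !andbT; apply/andP; split; apply/eqP => ye; subst.
    by move: cab; rewrite !lt_neqAle c1 c2 yc !andbT negbK => /eqP cb; lra.
  move: cab; rewrite !lt_neqAle c1 c2 !andbT (eq_sym c) yc andbT negbK => /eqP ca.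
  by move: y3; rewrite ca opprB ltxx.
have h1 : `|g c - (f y - f c) / (y - c)| < e / 2 by apply: (near dfc' y).
have h2 := key c y abc ayb yc.
have h3 : C * `|y - c| < e / 2.
  have : `|c - y| < e / 2 / (C + 1).
    by near: y; apply: near_dist_lt; rewrite divr_gt0.
  rewrite distrC ltr_pdivlMr// => h; apply: le_lt_trans h.
  by rewrite mulrC ler_wpM2l// lerDl.
rewrite (_ : g c - g y = (g c - (f y - f c) / (y - c)) + ((f y - f c) / (y - c) - g y)); last by ring.
by apply: le_lt_trans (ler_normD _ _) _; lra.
Unshelve. all: by end_near. Qed.

Section within.
Context {R : realType} (A : set R).
Implicit Types h k : R -> R.

Lemma within_continuousM h k : {within A, continuous h} -> {within A, continuous k} ->
  {within A, continuous (fun x => h x * k x)}.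
Proof. by move=> ch ck x; apply: continuousM; [exact: ch|exact: ck]. Qed.

Lemma within_continuousD h k : {within A, continuous h} -> {within A, continuous k} ->
  {within A, continuous (fun x => h x + k x)}.
Proof. by move=> ch ck x; apply: continuousD; [exact: ch|exact: ck]. Qed.

Lemma within_continuous_cst (c : R) : {within A, continuous (fun=> c)}.
Proof. by apply: continuous_subspaceT => x; exact: cvg_cst. Qed.

Lemma within_continuousX2 h : {within A, continuous h} ->
  {within A, continuous (fun x => h x ^+ 2)}.
Proof. by move=> ch; under eq_fun do rewrite expr2; exact: within_continuousM. Qed.

Lemma within_continuous_measurable h : measurable A -> {within A, continuous h} ->
  measurable_fun A h.
Proof. by move=> mA ch; exact: subspace_continuous_measurable_fun. Qed.
End within.

Lemma continuous_itv_integrable (R : realType) (h : R -> R) (a b : R) :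
  {within `[a, b], continuous h} ->
  lebesgue_measure.-integrable `[a, b] (EFin \o h).
Proof.
by move=> ch; apply: continuous_compact_integrable => //; exact: segment_compact.
Qed.

Lemma Rintegral_cst_itv (R : realType) (a b r : R) : a < b ->
  \int[lebesgue_measure]_(x in `[a, b]) (cst r x) = r * (b - a).
Proof.
move=> ab; rewrite Rintegral_cst//.
transitivity (r * fine (lebesgue_measure (`[a, b]%classic : set R))) => //.
by rewrite lebesgue_measure_itv /= lte_fin ab.
Qed.

Lemma is_derive_ext (R : realType) (F G : R -> R) (x dF dG : R) :
  is_derive x 1 F dF -> F =1 G -> dF = dG -> is_derive x 1 G dG.
Proof. by move=> + /funext <- <-. Qed.

Lemma increment_ge_of_derive_ge (R : realType) (F dF : R -> R) (a b m : R) : a <= b ->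
  {within `[a, b], continuous F} ->
  (forall x, a < x < b -> is_derive x 1 F (dF x)) ->
  (forall x, a < x < b -> m <= dF x) ->
  m * (b - a) <= F b - F a.
Proof.
rewrite le_eqVlt => /predU1P[->|ab] cF dFx mF; first by rewrite !subrr mulr0.
have dF' x : x \in `]a, b[ -> is_derive x 1 F (dF x) by rewrite in_itv/=; exact: dFx.
have [x] := MVT ab dF' cF.
by rewrite in_itv/= => /mF mx ->; rewrite ler_wpM2r// subr_ge0 ltW.
Qed.

(** Monotone convergence along the segments [[0, n]]. *)
Lemma integral_halfline_le (R : realType) (h : R -> R) (C : R) :
  {within `[0, +oo[, continuous h} -> (forall x, 0 <= x -> 0 <= h x) ->
  (forall M, 0 < M -> (\int[lebesgue_measure]_(x in `[0%R, M]) (h x)%:E <= C%:E)%E) ->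
  (\int[lebesgue_measure]_(x in `[0%R, +oo[) (h x)%:E <= C%:E)%E.
Proof.
move=> ch h0 hC; rewrite itv_bndy_bigcup_BRight.
pose I i : set R := `[0, 0 + i%:R]%classic.
have sub i : I i `<=` `[0, +oo[%classic.
  by move=> x; rewrite /I /= !in_itv/= andbT => /andP[].
have ndI : nondecreasing_seq I.
  move=> i j ij; rewrite subsetEset => x; rewrite /I/= !in_itv/= => /andP[-> /=].
  by move=> /le_trans; apply; rewrite lerD2l ler_nat.
have mI i : measurable_fun (I i) (fun x => (h x)%:E).
  apply/measurable_EFinP; apply: within_continuous_measurable.
    exact: measurable_itv.
  exact: continuous_subspaceW (sub i) ch.
have I0 i x : I i x -> (0 <= (h x)%:E)%E.
  by move=> /sub/=; rewrite in_itv/= andbT lee_fin => /h0.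
have cvI := @ge0_nondecreasing_set_cvg_integral _ (measurableTypeR R) R I _
  (@lebesgue_measure R) ndI (fun=> measurable_itv _) mI I0.
rewrite -(cvg_lim _ cvI)//; apply: lime_le; first by apply/cvg_ex; eexists; exact: cvI.
by exists 1%N => // n /= n0; apply: hC; rewrite add0r ltr0n.
Qed.

(** * The linear equation *)

(** The linear system [f' = g], [g' = V f]. The real and imaginary parts of a
    bound state both solve it on every edge (on every initial segment of a
    half-line), with the common real potential
    [V = lambda - kappa |u|^(p-2)]; treating [V] as given is what allows the two
    parts to be studied separately. *)
Record linear_ode (R : realType) (V f g : R -> R) (l : R) : Prop := {
  ode_contV : {within `[0, l], continuous V};
  ode_contf : {within `[0, l], continuous f};
  ode_contg : {within `[0, l], continuous g};
  ode_df : forall x, 0 < x < l -> is_derive x 1 f (g x);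
  ode_dg : forall x, 0 < x < l -> is_derive x 1 g (V x * f x)
}.

Lemma ode_derive_fg (R : realType) (V f g : R -> R) (l x : R) :
  linear_ode V f g l -> 0 < x < l ->
  is_derive x 1 (fun y => f y * g y) (g x ^+ 2 + V x * f x ^+ 2).
Proof.
move=> [_ _ _ df dg] xl.
apply: is_derive_ext (is_deriveM (df x xl) (dg x xl)) _ _ => //.
by rewrite /GRing.scale/=; ring.
Qed.

(** Multiplying [g' = V f] by [f] and integrating by parts, since [(f g)' = g^2 + V f^2]. *)
Lemma energy_identity (R : realType) (V f g : R -> R) (l : R) : 0 <= l ->
  linear_ode V f g l ->
  \int[lebesgue_measure]_(x in `[0, l]) (g x ^+ 2 + V x * f x ^+ 2) =
  f l * g l - f 0 * g 0.
Proof.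
move=> l0 H; have [cV cf cg df dg] := H.
apply: (@Rintegral_FTC2 _ (fun x => f x * g x)) => //.
- exact: within_continuousM.
- apply: within_continuousD; first exact: within_continuousX2.
  by apply: within_continuousM => //; exact: within_continuousX2.
- by move=> x; exact: ode_derive_fg.
Qed.

Section halfline.
Context {R : realType} (lam : R) (f g : R -> R).
Hypothesis fg_ode : forall M, 0 < M -> linear_ode (fun=> lam) f g M.
Hypothesis cf : {within `[0, +oo[, continuous f}.
Hypothesis cg : {within `[0, +oo[, continuous g}.
Hypothesis f_L2 :
  (\int[lebesgue_measure]_(x in `[0%R, +oo[) (f x ^+ 2)%:E < +oo)%E.

Lemma halfline_L2_bound : exists C, forall M,
  \int[lebesgue_measure]_(x in `[0, M]) (f x ^+ 2) <= C.
Proof.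
exists (fine (\int[lebesgue_measure]_(x in `[0%R, +oo[) (f x ^+ 2)%:E)%E) => M.
rewrite /Rintegral; apply: fine_le.
- apply: integrable_fin_num => //; apply: continuous_itv_integrable.
  apply: within_continuousX2; apply: continuous_subspaceW cf.
  by move=> x /=; rewrite !in_itv/= andbT => /andP[].
- by rewrite ge0_fin_numE//; apply: integral_ge0 => x _; rewrite lee_fin sqr_ge0.
- apply: ge0_subset_integral => //.
  + apply/measurable_EFinP; apply: within_continuous_measurable => //.
    exact: within_continuousX2.
  + by move=> x _; rewrite lee_fin sqr_ge0.
  + by move=> x /=; rewrite !in_itv/= andbT => /andP[].
Qed.

(** For [lam >= 0] the product [f g] is nondecreasing. If it were positive
    somewhere, then [(f^2)' = 2 f g] would stay bounded below by a positive constant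
    from there on, so [f^2] would grow at least linearly and not be integrable. *)
Lemma halfline_mul_le0 : 0 <= lam -> forall x, 0 <= x -> f x * g x <= 0.
Proof.
move=> lam0 x0 x00; rewrite leNgt; apply/negP => c0.
have [C fC] := halfline_L2_bound.
set c := f x0 * g x0 in c0.
have subA (a b : R) : 0 <= a -> `[a, b] `<=` `[0, +oo[%classic.
  by move=> a0 x /=; rewrite !in_itv/= andbT => /andP[/(le_trans a0)].
have cW (a b : R) (h : R -> R) : 0 <= a -> {within `[0, +oo[, continuous h} ->
    {within `[a, b], continuous h}.
  by move=> a0; apply: continuous_subspaceW; exact: subA.
have fgc (x : R) : x0 <= x -> c <= f x * g x.
  move=> x0x; rewrite -subr_ge0 -(mul0r (x - x0)).
  apply: (@increment_ge_of_derive_ge _ (fun y => f y * g y) (fun y => g y ^+ 2 + lam * f y ^+ 2)) => //.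
  - by apply: cW => //; exact: within_continuousM.
  - move=> y /andP[x0y yx].
    apply: (ode_derive_fg (l := x) (V := fun=> lam)).
      by apply: fg_ode; apply: le_lt_trans (lt_trans x0y yx).
    by rewrite yx andbT (le_lt_trans x00).
  - by move=> y _; rewrite addr_ge0 ?sqr_ge0// mulr_ge0// sqr_ge0.
have f2 x : x0 <= x -> (2 * c) * (x - x0) <= f x ^+ 2.
  move=> x0x; apply: (@le_trans _ _ (f x ^+ 2 - f x0 ^+ 2)); last first.
    by rewrite gerBl sqr_ge0.
  apply: (@increment_ge_of_derive_ge _ (fun y => f y ^+ 2) (fun y => 2 * (f y * g y))) => //.
  - by apply: cW => //; exact: within_continuousX2.
  - move=> y /andP[x0y yx].
    have [_ _ _ df _] := fg_ode (le_lt_trans x00 (lt_trans x0y yx)).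
    have dfy : is_derive y 1 f (g y).
      by apply: df; rewrite yx andbT (le_lt_trans x00).
    apply: is_derive_ext (is_deriveM dfy dfy) _ _ => //.
    by rewrite /GRing.scale/=; ring.
  - by move=> y /andP[/ltW x0y _]; rewrite ler_wpM2l// fgc.
(* from x1 on, the linear lower bound f2 exceeds 1 *)
pose x1 := x0 + (2 * c)^-1.
have x1x0 : x0 <= x1 by rewrite lerDl invr_ge0 mulr_ge0// ltW.
have x10 : 0 <= x1 := le_trans x00 x1x0.
have f1 x : x1 <= x -> 1 <= f x ^+ 2.
  move=> x1x; apply: le_trans (f2 x (le_trans x1x0 x1x)).
  have c20 : 0 < 2 * c by rewrite mulr_gt0.
  by rewrite -[leLHS](mulfV (lt0r_neq0 c20)) ler_pM2l// lerBrDl.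
(* an interval [x1, M] too long for the L2 bound C *)
pose M := x1 + (`|C| + 1).
have x1M : x1 < M by rewrite ltrDl ltr_pwDr.
have := fC M; apply/negP; rewrite -ltNge.
apply: (@lt_le_trans _ _ (M - x1)).
  by rewrite /M addrAC subrr add0r; apply: (le_lt_trans (ler_norm C)); rewrite ltrDl.
have -> : M - x1 = \int[lebesgue_measure]_(x in `[x1, M]) (cst 1 x).
  by rewrite Rintegral_cst_itv// mul1r.
have iM (a : R) : 0 <= a -> lebesgue_measure.-integrable `[a, M] (EFin \o (fun x => f x ^+ 2)).
  move=> a0; apply: continuous_itv_integrable; apply: cW => //.
  exact: within_continuousX2.
apply: (@le_trans _ _ (\int[lebesgue_measure]_(x in `[x1, M]) (f x ^+ 2))).
  apply: le_Rintegral => //.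
  - by apply: continuous_itv_integrable; exact: within_continuous_cst.
  - exact: iM.
  - by move=> x /=; rewrite in_itv/= => /andP[/f1].
apply: fine_le.
- by apply: integrable_fin_num => //; exact: iM.
- by apply: integrable_fin_num => //; exact: iM.
- apply: ge0_subset_integral => //.
  + by have /integrableP[] := iM 0 (lexx _).
  + by move=> x _; rewrite lee_fin sqr_ge0.
  + by move=> x /=; rewrite !in_itv/= => /andP[/(le_trans x10) -> ->].
Qed.

(** The boundary term at [M] in the energy identity on [[0, M]] has a favourable
    sign by [halfline_mul_le0], so the bound is uniform in [M]. This is also the
    reason why [g] is square integrable. *)
Lemma halfline_energy : 0 <= lam ->
  (\int[lebesgue_measure]_(x in `[0%R, +oo[) (g x ^+ 2)%:E <= (- (f 0 * g 0))%:E)%E.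
Proof.
move=> lam0; apply: integral_halfline_le.
- exact: within_continuousX2.
- by move=> x _; exact: sqr_ge0.
move=> M M0; have H := fg_ode M0; have [cV cf' cg' df dg] := H.
have i1 : lebesgue_measure.-integrable `[0, M] (EFin \o (fun x => g x ^+ 2)).
  by apply: continuous_itv_integrable; exact: within_continuousX2.
have i2 : lebesgue_measure.-integrable `[0, M]
    (EFin \o (fun x => g x ^+ 2 + lam * f x ^+ 2)).
  apply: continuous_itv_integrable; apply: within_continuousD.
    exact: within_continuousX2.
  by apply: within_continuousM => //; exact: within_continuousX2.
rewrite -(fineK (integrable_fin_num _ i1))// lee_fin.
apply: (@le_trans _ _ (\int[lebesgue_measure]_(x in `[0, M]) (g x ^+ 2 + lam * f x ^+ 2))).
  by apply: le_Rintegral => // x _; rewrite lerDl mulr_ge0// sqr_ge0.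
rewrite (energy_identity (ltW M0) H) gerDr.
exact: halfline_mul_le0 (ltW M0).
Qed.

(** For [lam < 0] the quantity [E = g^2 - lam f^2] is constant and
    [(f g)' = E + 2 lam f^2]. Since [f g] is bounded by a multiple of [E] and
    [f^2] is integrable, integrating over [[0, M]] bounds [E M] independently of
    [M], so [E = 0]. *)
Lemma halfline_neg_eq0 : lam < 0 -> forall x, 0 <= x -> f x = 0.
Proof.
move=> lam0.
have [C fC] := halfline_L2_bound.
pose E0 := g 0 ^+ 2 - lam * f 0 ^+ 2.
have cW (M : R) (h : R -> R) : {within `[0, +oo[, continuous h} -> {within `[0, M], continuous h}.
  by apply: continuous_subspaceW => x /=; rewrite !in_itv/= andbT => /andP[].
have Ex x : 0 <= x -> g x ^+ 2 + - lam * f x ^+ 2 = E0.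
  rewrite le_eqVlt => /predU1P[<-|x0]; first by rewrite /E0 mulNr.
  have H := fg_ode x0; have [_ cf' cg' df dg] := H.
  have [||y _] := @MVT R (fun y => g y ^+ 2 + - lam * f y ^+ 2) (fun=> 0) 0 x x0.
  - move=> y; rewrite in_itv/= => yx.
    have dfy := df y yx; have dgy := dg y yx.
    apply: is_derive_ext (is_deriveD (is_deriveM dgy dgy)
      (is_deriveZ (- lam) (is_deriveM dfy dfy))) _ _ => //.
    by rewrite /GRing.scale/=; ring.
  - apply: within_continuousD; first exact: within_continuousX2.
    by apply: within_continuousM; [exact: within_continuous_cst|exact: within_continuousX2].
  by rewrite mul0r => /eqP; rewrite subr_eq0 => /eqP ->; rewrite /E0 mulNr.
have E00 : E0 = 0.
  apply/eqP; rewrite eq_le; apply/andP; split; last first.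
    rewrite -(Ex 0 (lexx _)) addr_ge0 ?sqr_ge0//.
    by rewrite mulr_ge0 ?sqr_ge0// oppr_ge0 ltW.
  rewrite leNgt; apply/negP => Epos.
  have fgB x : 0 <= x -> `|f x * g x| <= E0 / - lam + E0.
    move=> /Ex Exx.
    have f1 : f x ^+ 2 <= E0 / - lam.
      by rewrite ler_pdivlMr ?oppr_gt0// mulrC -Exx lerDr sqr_ge0.
    have g1 : g x ^+ 2 <= E0.
      by rewrite -Exx lerDl mulr_ge0 ?sqr_ge0// oppr_ge0 ltW.
    have h1 := sqr_ge0 (f x - g x); have h2 := sqr_ge0 (f x + g x).
    have h3 := sqr_ge0 (f x); have h4 := sqr_ge0 (g x).
    by rewrite ler_norml; apply/andP; split; nra.
  set B := E0 / - lam + E0 in fgB.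
  have key M : 0 < M -> E0 * M <= 2 * B + 2 * - lam * C.
    move=> M0; have H := fg_ode M0; have [cV cf' cg' df dg] := H.
    have i1 : lebesgue_measure.-integrable `[0, M] (EFin \o (fun x => f x ^+ 2)).
      by apply: continuous_itv_integrable; exact: within_continuousX2.
    have i2 : lebesgue_measure.-integrable `[0, M]
        (EFin \o (fun x => g x ^+ 2 + lam * f x ^+ 2)).
      apply: continuous_itv_integrable; apply: within_continuousD.
        exact: within_continuousX2.
      by apply: within_continuousM => //; exact: within_continuousX2.
    have i3 : lebesgue_measure.-integrable `[0, M] (EFin \o (fun x => 2 * - lam * f x ^+ 2)).
      apply: continuous_itv_integrable; apply: within_continuousM.
        exact: within_continuous_cst.
      exact: within_continuousX2.
    have -> : E0 * M = \int[lebesgue_measure]_(x in `[0, M]) (cst E0 x).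
      by rewrite Rintegral_cst_itv// subr0.
    have -> : \int[lebesgue_measure]_(x in `[0, M]) (cst E0 x) =
        \int[lebesgue_measure]_(x in `[0, M])
          ((g x ^+ 2 + lam * f x ^+ 2) + (2 * - lam * f x ^+ 2)).
      apply: eq_Rintegral => x; rewrite inE/= in_itv/= => /andP[/Ex <- _]; ring.
    rewrite RintegralD// (energy_identity (ltW M0) H) RintegralZl//.
    apply: lerD.
      have := fgB 0 (lexx _); have := fgB M (ltW M0).
      by rewrite !ler_norml => /andP[? ?] /andP[? ?]; lra.
    by rewrite ler_wpM2l// mulr_ge0// oppr_ge0 ltW.
  (* taking M large enough contradicts key *)
  pose K := 2 * B + 2 * - lam * C.
  have K1 : 0 < `|K| + 1 by rewrite ltr_pwDr.
  have := key ((`|K| + 1) / E0) (divr_gt0 K1 Epos).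
  rewrite mulrCA divff ?gt_eqF// mulr1 -/K; have := ler_norm K; lra.
move=> x /Ex; rewrite E00 => /eqP.
have lamf : 0 <= - lam * f x ^+ 2 by rewrite mulr_ge0 ?sqr_ge0// oppr_ge0 ltW.
rewrite paddr_eq0 ?sqr_ge0// => /andP[_].
by rewrite mulf_eq0 oppr_eq0 lt_eqF//= sqrf_eq0 => /eqP.
Qed.

End halfline.

(** * Real and imaginary parts *)

Section complex_parts.
Context {R : realType}.
Implicit Types (z : R[i]) (F : R -> R[i]^o) (A : set R).

Lemma cvg_Re (T : Type) (Fl : set_system T) (FFl : Filter Fl) (F : T -> R[i]^o) (l : R[i]^o) :
  F x @[x --> Fl] --> l -> complex.Re (F x) @[x --> Fl] --> complex.Re l.
Proof.
move=> /cvgrPdist_lt Fl_; apply/cvgrPdist_lt => e e0.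
have := Fl_ (e%:C)%C; rewrite ltcR => /(_ e0); apply: filterS => x.
move=> /(le_lt_trans (normc_ge_Re _)); rewrite ltcR.
by case: (l) (F x) => [a b] [c d].
Qed.

Lemma cvg_Im (T : Type) (Fl : set_system T) (FFl : Filter Fl) (F : T -> R[i]^o) (l : R[i]^o) :
  F x @[x --> Fl] --> l -> complex.Im (F x) @[x --> Fl] --> complex.Im l.
Proof.
move=> /cvgrPdist_lt Fl_; apply/cvgrPdist_lt => e e0.
have := Fl_ (e%:C)%C; rewrite ltcR => /(_ e0); apply: filterS => x.
have -> : `|l - F x| = `|(l - F x) * 'i%C| by rewrite normrM [`|'i%C|]normc_def /= expr0n add0r expr1n sqrtr1 mulr1.
move=> /(le_lt_trans (normc_ge_Re _)); rewrite ltcR ReiNIm normrN.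
by case: (l) (F x) => [a b] [c d].
Qed.

Lemma Re_within_continuous A F : {within A, continuous F} ->
  {within A, continuous (fun x => complex.Re (F x))}.
Proof. by move=> cF x; apply: cvg_Re; exact: cF. Qed.

Lemma Im_within_continuous A F : {within A, continuous F} ->
  {within A, continuous (fun x => complex.Im (F x))}.
Proof. by move=> cF x; apply: cvg_Im; exact: cF. Qed.

Lemma Re_divr z (t : R) : complex.Re (z / (t%:C)%C) = complex.Re z / t.
Proof. by rewrite -fmorphV; case: z => a b /=; rewrite mulr0 subr0. Qed.

Lemma Im_divr z (t : R) : complex.Im (z / (t%:C)%C) = complex.Im z / t.
Proof. by rewrite -fmorphV; case: z => a b /=; rewrite mulr0 add0r. Qed.

Lemma Re_derivative_within A F x (d : R[i]^o) : derivative_within A F x d ->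
  real_derivative_within A (fun y => complex.Re (F y)) x (complex.Re d).
Proof.
move=> /cvg_Re; rewrite /real_derivative_within.
under eq_fun do rewrite Re_divr.
by under eq_fun do rewrite raddfB/=.
Qed.

Lemma Im_derivative_within A F x (d : R[i]^o) : derivative_within A F x d ->
  real_derivative_within A (fun y => complex.Im (F y)) x (complex.Im d).
Proof.
move=> /cvg_Im; rewrite /real_derivative_within.
under eq_fun do rewrite Im_divr.
by under eq_fun do rewrite raddfB/=.
Qed.

Lemma normc_sqr z : Normc.normc z ^+ 2 = complex.Re z ^+ 2 + complex.Im z ^+ 2.
Proof. by case: z => a b /=; rewrite sqr_sqrtr// addr_ge0 ?sqr_ge0. Qed.

Lemma normc_ge0 z : 0 <= Normc.normc z.
Proof. by case: z => a b /=; exact: sqrtr_ge0. Qed.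

Lemma within_continuous_normc A F : {within A, continuous F} ->
  {within A, continuous (fun x => Normc.normc (F x))}.
Proof.
move=> cF; have -> : (fun x => Normc.normc (F x)) =
    (fun x => Num.sqrt (complex.Re (F x) ^+ 2 + complex.Im (F x) ^+ 2)).
  by apply/funext => x; case: (F x).
move=> x; apply: (@continuous_comp _ _ _ (fun x => _ : R) Num.sqrt); last exact: sqrt_continuous.
apply: within_continuousD; apply: within_continuousX2.
  exact: Re_within_continuous.
exact: Im_within_continuous.
Qed.

(** The power function is discontinuous at [0] on the whole line, as it takes the
    value [1] at negative arguments; hence the sign condition on [h]. *)
Lemma within_continuous_powR A (h : R -> R) (q : R) : 0 < q ->
  (forall x, 0 <= h x) ->
  {within A, continuous h} -> {within A, continuous (fun x => h x `^ q)}.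
Proof.
move=> q0 h0 /subspace_continuousP ch; apply/subspace_continuousP => x Ax.
have := ch x Ax; rewrite /from_subspace => hx.
have [hx0|hx0] := eqVneq (h x) 0.
  apply/cvgrPdist_lt => e e0; rewrite hx0 powR0 ?gt_eqF//.
  have e1 : 0 < e `^ q^-1 by rewrite powR_gt0.
  move/cvgrPdist_lt : hx => /(_ _ e1); apply: filterS => y.
  rewrite hx0 !sub0r !normrN !ger0_norm ?powR_ge0// => hy.
  have := gt0_ltr_powR q0 _ _ hy; rewrite -powRrM mulVf ?gt_eqF// powRr1 ?ltW//.
  by apply; rewrite nnegrE// ltW.
have hxp : h x \in `]0, +oo[ by rewrite in_itv/= andbT lt_neqAle eq_sym hx0 h0.
have cq : {for h x, continuous (fun a => a `^ q)}.
  apply: differentiable_continuous; rewrite -derivable1_diffP.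
  exact: derivable_powR.
exact: (cvg_comp _ _ hx cq).
Qed.

End complex_parts.

(** * Pointwise and weak derivatives *)

Lemma real_derivative_withinS (R : realType) (A B : set R) (f : R -> R) (x d : R) :
  A `<=` B -> real_derivative_within B f x d -> real_derivative_within A f x d.
Proof.
move=> AB; rewrite /real_derivative_within; apply: cvg_trans.
by move=> P; rewrite /nbhs/= /fmap/= /within/=; apply: filterS => y h /AB.
Qed.

(** The regularity that the notion of bound state leaves implicit: [g] is only
    assumed to be the pointwise derivative of [f] up to the endpoints, and its
    continuity there comes from the boundedness of [g' = V f]. *)
Lemma linear_ode_of_derivatives (R : realType) (l : R) (V f g : R -> R) : 0 < l ->
  {within `[0, l], continuous V} ->
  {within `[0, l], continuous f} ->
  (forall x, `[0, l]%classic x -> real_derivative_within `[0, l] f x (g x)) ->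
  (forall x, 0 < x < l -> is_derive x 1 g (V x * f x)) ->
  linear_ode V f g l.
Proof.
move=> l0 cV cf df dg.
have cVf : {within `[0, l], continuous (fun x => `|V x * f x|)}.
  have cVf : {within `[0, l], continuous (fun x => V x * f x)}.
    exact: within_continuousM.
  by move=> x; apply: cvg_norm; exact: cVf.
have [c _ cM] := EVT_max (ltW l0) cVf.
split=> //.
- apply: (derivative_within_continuous l0 cf df dg (C := `|V c * f c|)) => x /andP[x0 xl].
  by apply: cM; rewrite in_itv/= !ltW.
- move=> x xl; apply: (@is_derive_interior _ `[0, l]).
    by rewrite interior_itv_bnd /= in_itv.
  by apply: df; rewrite /= in_itv/=; case/andP: xl => /ltW -> /ltW ->.
Qed.

Lemma segment_by_parts (R : realType) (l : R) (V f g phi : R -> R) : 0 < l ->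
  linear_ode V f g l ->
  (forall (n : nat) (x : R), derivable (phi^`(n))%classic x 1) ->
  phi 0 = 0 -> phi l = 0 ->
  \int[lebesgue_measure]_(x in `[0, l]) (f x * (phi^`())%classic x) =
  - \int[lebesgue_measure]_(x in `[0, l]) (g x * phi x).
Proof.
move=> l0 [_ cf cg df _] dphi phi0 phil.
have dphi0 (x : R) : is_derive x 1 phi ((phi^`())%classic x).
  by split; [exact: (dphi 0)|rewrite derive1E].
have cphi : {within `[0, l], continuous phi}.
  by apply: continuous_subspaceT => x; exact: is_derive_at_continuous.
have cdphi : {within `[0, l], continuous (phi^`())%classic}.
  apply: continuous_subspaceT => x; apply: differentiable_continuous.
  by rewrite -derivable1_diffP; exact: (dphi 1).
have i1 : lebesgue_measure.-integrable `[0, l] (EFin \o (fun x => f x * (phi^`())%classic x)).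
  by apply: continuous_itv_integrable; exact: within_continuousM.
have i2 : lebesgue_measure.-integrable `[0, l] (EFin \o (fun x => g x * phi x)).
  by apply: continuous_itv_integrable; exact: within_continuousM.
apply/eqP; rewrite -addr_eq0 -RintegralD//; apply/eqP.
transitivity (f l * phi l - f 0 * phi 0); last by rewrite phi0 phil !mulr0 subrr.
apply: (@Rintegral_FTC2 _ (fun x => f x * phi x)).
- exact: ltW.
- exact: within_continuousM.
- by apply: within_continuousD; exact: within_continuousM.
- move=> x xl; apply: is_derive_ext (is_deriveM (df x xl) (dphi0 x)) _ _ => //.
  by rewrite /GRing.scale/= [phi x * _]mulrC.
Qed.

Lemma weak_derivative_segment (R : realType) (l : R) (V f g : R -> R) : 0 < l ->
  linear_ode V f g l -> weak_derivative `[0, l] f g.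
Proof.
move=> l0 H phi [dphi [K [_ KI phiK]]].
apply: (segment_by_parts l0 H) => //; apply: phiK => /KI.
  by rewrite interior_itv_bnd /= in_itv/= ltxx.
by rewrite interior_itv_bnd /= in_itv/= ltxx andbF.
Qed.

Lemma Rintegral_halfline_segment (R : realType) (h : R -> R) (M : R) : 
  (forall x, M < x -> h x = 0) ->
  \int[lebesgue_measure]_(x in `[0, +oo[) h x = \int[lebesgue_measure]_(x in `[0, M]) h x.
Proof.
move=> hM; rewrite [LHS]Rintegral_mkcond [RHS]Rintegral_mkcond; congr Rintegral.
apply/funext => x; rewrite /patch !mem_setE !in_itv/= andbT.
have [x0|//] := leP 0 x.
by have [//|/hM ->] := leP x M.
Qed.

(** A test function is supported in some segment [[0, M]], where the integration
    by parts on a segment applies. *)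
Lemma weak_derivative_halfline (R : realType) (V f g : R -> R) :
  (forall M, 0 < M -> linear_ode V f g M) -> weak_derivative `[0, +oo[ f g.
Proof.
move=> H phi [dphi [K [cK KI phiK]]].
have [M [M0 KM]] : exists M, 0 < M /\ forall x, K x -> x < M.
  have [B [_ BK]] := compact_bounded cK.
  exists (`|B| + 2); split; first by rewrite ltr_wpDl.
  move=> x Kx; have /BK /(_ _ Kx) h : B < `|B| + 1.
    by rewrite (le_lt_trans (ler_norm _))// ltrDl.
  by rewrite (le_lt_trans (ler_norm x))// (le_lt_trans h)// ltrD2l ltr1n.
have phiM (x : R) : M <= x -> phi x = 0.
  by move=> Mx; apply: phiK => /KM; rewrite ltNge Mx.
have dphiM (x : R) : M < x -> (phi^`())%classic x = 0.
  move=> Mx; rewrite derive1E; apply: derive_val.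
  apply: (@is_derive_interior _ setT); first by rewrite interiorT.
  apply: cvg_near_cst; apply: cvg_within.
  near=> y.
  have My : M < y by near: y; apply: nbhs_dnbhs; exact: lt_nbhsr.
  by rewrite (phiM _ (ltW My)) (phiM _ (ltW Mx)) subrr mul0r.
have phi0 : phi 0 = 0.
  by apply: phiK => /KI; rewrite interior_itv_bndy /= in_itv/= ltxx.
rewrite (@Rintegral_halfline_segment _ _ M); last by move=> x /dphiM ->; rewrite mulr0.
rewrite [in RHS](@Rintegral_halfline_segment _ _ M).
  exact: (segment_by_parts M0 (H _ M0)) (phiM _ (lexx _)).
by move=> x /ltW /phiM ->; rewrite mulr0.
Unshelve. all: by end_near. Qed.

(** * The flux through the vertices *)

(** By connectedness; this makes the Kirchhoff condition available at every
    vertex, in particular where the half-lines are attached. *)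
Lemma core_nonempty_in_core (R : realType) (G : metric_graph R) (v : vertex G) :
  core_nonempty G -> in_core v.
Proof.
move=> /card_gt0P[b _].
have /connectP[[|w s] /= vs vb] := graph_connected v (esrc b).
  by exists b; left.
have /andP[/existsP[c /orP[]/andP[/eqP cv /eqP cw]] _] := vs.
  by exists c; left.
by exists c; right.
Qed.

Section cdot.
Context {R : realType}.
Implicit Types z w : R[i].

(** The real scalar product [Re (conj z * w)]. *)
Definition cdot z w : R :=
  complex.Re z * complex.Re w + complex.Im z * complex.Im w.

Lemma cdot0 z : cdot z 0 = 0.
Proof. by rewrite /cdot /= !mulr0 addr0. Qed.

Lemma cdotD z : {morph cdot z : w1 w2 / w1 + w2}.
Proof. by move=> [a b] [c d]; rewrite /cdot /=; ring. Qed.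

Lemma cdotN z : {morph cdot z : w / - w}.
Proof. by move=> [a b]; rewrite /cdot /=; ring. Qed.

Lemma cdot_sum z (I : Type) (r : seq I) (P : pred I) (F : I -> R[i]) :
  cdot z (\sum_(i <- r | P i) F i) = \sum_(i <- r | P i) cdot z (F i).
Proof. exact: (big_morph _ (cdotD z) (cdot0 z)). Qed.
End cdot.

(** Pairing the Kirchhoff condition at each vertex with the value of [u] there and
    summing over the vertices distributes the boundary terms over the edges. *)
Lemma kirchhoff_flux (R : realType) (G : metric_graph R) (u du : graph_fun G)
    (uv : vertex G -> R[i]) :
  (forall b : bedge G, u (inl b) 0 = uv (esrc b) /\ u (inl b) (elen b) = uv (etgt b)) ->
  (forall h : halfline G, u (inr h) 0 = uv (hroot h)) ->
  (forall v : vertex G, kirchhoff_sum du v = 0) ->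
  \sum_(b : bedge G) (cdot (u (inl b) (elen b)) (du (inl b) (elen b))
                      - cdot (u (inl b) 0) (du (inl b) 0))
  = \sum_(h : halfline G) cdot (u (inr h) 0) (du (inr h) 0).
Proof.
move=> ub uh K.
have part (I : finType) (end_ : I -> vertex G) (F : I -> R[i]) :
    \sum_(i : I) cdot (uv (end_ i)) (F i) =
    \sum_(v : vertex G) cdot (uv v) (\sum_(i | end_ i == v) F i).
  rewrite (partition_big end_ xpredT)//=; apply: eq_bigr => v _.
  by rewrite cdot_sum; apply: eq_bigr => i /eqP ->.
have : \sum_(v : vertex G) cdot (uv v) (kirchhoff_sum du v) = 0.
  by rewrite big1 // => v _; rewrite K cdot0.
rewrite /kirchhoff_sum; under eq_bigr do rewrite !cdotD.
rewrite 2!big_split/= -(part _ (@esrc R G)) -(part _ (@etgt R G)) -(part _ (@hroot R G)) sumrB.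
rewrite (eq_bigr (fun b => cdot (u (inl b) 0) (du (inl b) 0))); last first.
  by move=> b _; have [-> _] := ub b.
rewrite [X in _ + X + _](eq_bigr (fun b => - cdot (u (inl b) (elen b)) (du (inl b) (elen b)))); last first.
  by move=> b _; have [_ ->] := ub b; rewrite cdotN.
rewrite sumrN [X in _ + _ + X](eq_bigr (fun h => cdot (u (inr h) 0) (du (inr h) 0))); last first.
  by move=> h _; rewrite uh.
by lra.
Qed.

(** * Norms on the graph *)

Section norms.
Context {R : realType} (G : metric_graph R).
Implicit Types (u : graph_fun G) (e : edge G).

Lemma measurable_edge_itv e : measurable (edge_itv e).
Proof. by case: e => ?; exact: measurable_itv. Qed.

Lemma edge_norm_poweR u e (q : R) : q != 0 ->
  (edge_norm q%:E u e `^ q =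
   \int[lebesgue_measure]_(x in edge_itv e) (Normc.normc (u e x) `^ q)%:E)%E.
Proof.
move=> q0; rewrite /edge_norm poweR_Lnorm// [RHS]integral_mkcond.
apply: eq_integral => x _; rewrite /patch.
case: ifPn => _; last by rewrite abse0 poweR0r.
by rewrite gee0_abs ?lee_fin ?normc_ge0.
Qed.

Lemma normc_powR2 (z : R[i]) :
  Normc.normc z `^ 2 = complex.Re z ^+ 2 + complex.Im z ^+ 2.
Proof. by rewrite -normc_sqr (powR_mulrn 2) ?normc_ge0. Qed.

Lemma edge_norm2_sqr u e :
  (edge_norm 2%:E u e `^ 2 =
   \int[lebesgue_measure]_(x in edge_itv e)
     (complex.Re (u e x) ^+ 2 + complex.Im (u e x) ^+ 2)%:E)%E.
Proof.
by rewrite edge_norm_poweR//; under eq_integral do rewrite normc_powR2.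
Qed.

Lemma Lp_norm_poweR u (q : R) : q != 0 ->
  (Lp_norm q u `^ q = \sum_(e : edge G) edge_norm q%:E u e `^ q)%E.
Proof.
move=> q0; rewrite /Lp_norm -poweRrM mulVf// poweRe1//.
by apply: sume_ge0 => e _; exact: poweR_ge0.
Qed.

Lemma edge_norm2_lty u e : (edge_norm 2%:E u e < +oo <->
   \int[lebesgue_measure]_(x in edge_itv e)
     (complex.Re (u e x) ^+ 2 + complex.Im (u e x) ^+ 2)%:E < +oo)%E.
Proof.
rewrite -edge_norm2_sqr; split; first exact: poweR_lty.
by apply: lty_poweRy.
Qed.

Lemma le_edge_norm_Linfty u e : (edge_norm +oo%E u e <= Linfty_norm u)%E.
Proof. exact: le_bigmax. Qed.

Lemma edge_Linfty_ae u e :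
  {ae lebesgue_measure, forall x, edge_itv e x ->
    ((Normc.normc (u e x))%:E <= edge_norm +oo%E u e)%E}.
Proof.
rewrite /edge_norm unlock.
have -> : (lebesgue_measure [set: R] > 0)%E.
  by rewrite -set_itvNyy lebesgue_measure_itv/= addey.
have := ess_sup_ge lebesgue_measure
  (abse \o (fun x : R => (Normc.normc (u e x))%:E) \_ (edge_itv e)).
apply: filterS => x /= + xe.
by rewrite patchE mem_set// gee0_abs ?lee_fin ?normc_ge0.
Qed.
End norms.

(** * Energy estimates for bound states *)

Section bound_state.
Context {R : realType} (G : metric_graph R) (p lam : R) (u du : graph_fun G).
Context (p_gt2 : 2 < p) (u_H1 : in_H1 u)
  (u_der : forall (e : edge G) (x : R), edge_itv e x ->
     derivative_within (edge_itv e) (u e) x (du e x))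
  (u_eq : forall (e : edge G) (x : R), (edge_itv e)° x ->
     exists d2u : R[i]^o,
       derivative_within (edge_itv e) (du e) x d2u /\
       d2u + ((kappa e * Normc.normc (u e x) `^ (p - 2))%:C)%C * u e x
         = (lam%:C)%C * u e x).

Let u_cont (e : edge G) : {within edge_itv e, continuous (u e)}.
Proof. by have [w []] := u_H1. Qed.

Let u_L2 : in_L2 u.
Proof. by have [w []] := u_H1. Qed.

Definition potential (e : edge G) (x : R) : R :=
  lam - kappa e * Normc.normc (u e x) `^ (p - 2).

Lemma edge_ode (e : edge G) (l : R) : 0 < l -> `[0, l] `<=` edge_itv e ->
  linear_ode (potential e) (fun x => complex.Re (u e x)) (fun x => complex.Re (du e x)) l /\
  linear_ode (potential e) (fun x => complex.Im (u e x)) (fun x => complex.Im (du e x)) l.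
Proof.
move=> l0 le.
have cu : {within `[0, l], continuous (u e)} by exact: continuous_subspaceW le (@u_cont e).
have cV : {within `[0, l], continuous (potential e)}.
  apply: within_continuousD; first exact: within_continuous_cst.
  move=> x; apply: cvgN; move: x; apply: within_continuousM.
    exact: within_continuous_cst.
  apply: within_continuous_powR; first by rewrite subr_gt0.
    by move=> x; exact: normc_ge0.
  exact: within_continuous_normc.
have int x : 0 < x < l -> (edge_itv e)° x.
  move=> xl; apply: (interiorS le); first by rewrite interior_itv_bnd /= in_itv.
have eq2 x : 0 < x < l -> exists d2u : R[i]^o,
    derivative_within (edge_itv e) (du e) x d2u /\
    d2u = ((potential e x)%:C)%C * u e x.
  move=> /int /u_eq[d [dd de]]; exists d; split => //.
  by rewrite /potential rmorphB/= mulrBl -de addrK.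
split; apply: linear_ode_of_derivatives => //.
- exact: Re_within_continuous.
- move=> x /le ex; apply: (real_derivative_withinS le).
  exact/Re_derivative_within/u_der.
- move=> x xl; have [d [dd de]] := eq2 x xl.
  have -> : potential e x * complex.Re (u e x) = complex.Re d.
    by rewrite de; case: (u e x) => a b /=; rewrite mul0r subr0.
  exact: is_derive_interior (int _ xl) (Re_derivative_within dd).
- exact: Im_within_continuous.
- move=> x /le ex; apply: (real_derivative_withinS le).
  exact/Im_derivative_within/u_der.
- move=> x xl; have [d [dd de]] := eq2 x xl.
  have -> : potential e x * complex.Im (u e x) = complex.Im d.
    by rewrite de; case: (u e x) => a b /=; rewrite mul0r addr0.
  exact: is_derive_interior (int _ xl) (Im_derivative_within dd).
Qed.

Lemma bedge_ode (b : bedge G) :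
  linear_ode (potential (inl b)) (fun x => complex.Re (u (inl b) x))
    (fun x => complex.Re (du (inl b) x)) (elen b) /\
  linear_ode (potential (inl b)) (fun x => complex.Im (u (inl b) x))
    (fun x => complex.Im (du (inl b) x)) (elen b).
Proof. by apply: edge_ode => //; exact: elen_gt0. Qed.

Lemma halfline_ode (h : halfline G) (M : R) : 0 < M ->
  linear_ode (fun=> lam) (fun x => complex.Re (u (inr h) x))
    (fun x => complex.Re (du (inr h) x)) M /\
  linear_ode (fun=> lam) (fun x => complex.Im (u (inr h) x))
    (fun x => complex.Im (du (inr h) x)) M.
Proof.
move=> M0; have -> : (fun=> lam) = potential (inr h).
  by apply/funext => x; rewrite /potential /kappa mul0r subr0.
by apply: edge_ode => // x /=; rewrite !in_itv/= andbT => /andP[].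
Qed.

Lemma halfline_du_continuous (h : halfline G) :
  {within `[0, +oo[, continuous (fun x => complex.Re (du (inr h) x))} /\
  {within `[0, +oo[, continuous (fun x => complex.Im (du (inr h) x))}.
Proof.
have ext (F : R -> R) : (forall M, 0 < M -> {within `[0, M], continuous F}) ->
    {within `[0, +oo[, continuous F}.
  move=> cF; apply/continuous_within_itvcyP; split.
    move=> x; rewrite in_itv/= andbT => x0.
    have x10 : 0 < x + 1 by rewrite ltr_wpDr.
    have [+ _ _] := (continuous_within_itvP _ x10).1 (cF _ x10); apply.
    by rewrite in_itv/= x0 ltrDl ltr01.
  by have [_ + _] := (continuous_within_itvP _ ltr01).1 (cF _ ltr01).
by split; apply: ext => M M0; have [[? ? ? ? ?] [? ? ? ? ?]] := halfline_ode h M0.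
Qed.

Lemma edge_du_continuous (e : edge G) :
  {within edge_itv e, continuous (fun x => complex.Re (du e x))} /\
  {within edge_itv e, continuous (fun x => complex.Im (du e x))}.
Proof.
case: e => [b|h]; last exact: halfline_du_continuous.
by have [[? ? ? ? ?] [? ? ? ? ?]] := bedge_ode b.
Qed.

Lemma halfline_u_L2 (h : halfline G) :
  (\int[lebesgue_measure]_(x in `[0%R, +oo[) (complex.Re (u (inr h) x) ^+ 2)%:E < +oo)%E /\
  (\int[lebesgue_measure]_(x in `[0%R, +oo[) (complex.Im (u (inr h) x) ^+ 2)%:E < +oo)%E.
Proof.
have [mRe mIm /edge_norm2_lty] := u_L2 (inr h).
rewrite [edge_itv _]/= => L2.
have mRe2 : measurable_fun (`[0, +oo[%classic : set R) (fun x => (complex.Re (u (inr h) x) ^+ 2)%:E).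
  by apply/measurable_EFinP; exact: measurable_funX.
have mIm2 : measurable_fun (`[0, +oo[%classic : set R) (fun x => (complex.Im (u (inr h) x) ^+ 2)%:E).
  by apply/measurable_EFinP; exact: measurable_funX.
have mS : measurable_fun (`[0, +oo[%classic : set R) (fun x =>
    (complex.Re (u (inr h) x) ^+ 2 + complex.Im (u (inr h) x) ^+ 2)%:E).
  by apply/measurable_EFinP; apply: measurable_funD; exact: measurable_funX.
split; apply: le_lt_trans L2; apply: ge0_le_integral => //.
- by move=> x _; rewrite lee_fin sqr_ge0.
- by move=> x _; rewrite lee_fin lerDl sqr_ge0.
- by move=> x _; rewrite lee_fin sqr_ge0.
- by move=> x _; rewrite lee_fin lerDr sqr_ge0.
Qed.

Lemma negative_multiplier_supported_on_core : lam < 0 -> supported_on_core u.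
Proof.
move=> lam0 h x; rewrite /= in_itv/= andbT => x0.
have cR := Re_within_continuous (@u_cont (inr h)).
have cI := Im_within_continuous (@u_cont (inr h)).
have [L2R L2I] := halfline_u_L2 h.
have [cdR cdI] := halfline_du_continuous h.
have hR := halfline_neg_eq0 (fun M M0 => (halfline_ode h M0).1) cR L2R lam0 x0.
have hI := halfline_neg_eq0 (fun M M0 => (halfline_ode h M0).2) cI L2I lam0 x0.
by move: hR hI; case: (u (inr h) x) => a b /= -> ->.
Qed.

Lemma halfline_gradient (h : halfline G) : 0 <= lam ->
  (\int[lebesgue_measure]_(x in edge_itv (inr h : edge G))
     (complex.Re (du (inr h) x) ^+ 2 + complex.Im (du (inr h) x) ^+ 2)%:E
   <= (- cdot (u (inr h) 0) (du (inr h) 0))%:E)%E.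
Proof.
move=> lam0.
have cR := Re_within_continuous (@u_cont (inr h)).
have cI := Im_within_continuous (@u_cont (inr h)).
have [L2R L2I] := halfline_u_L2 h.
have [cdR cdI] := halfline_du_continuous h.
have hR := halfline_energy (fun M M0 => (halfline_ode h M0).1) cR cdR L2R lam0.
have hI := halfline_energy (fun M M0 => (halfline_ode h M0).2) cI cdI L2I lam0.
under eq_integral do rewrite EFinD.
rewrite ge0_integralD//=; last 4 first.
- by move=> x _; rewrite lee_fin sqr_ge0.
- apply/measurable_EFinP; apply: within_continuous_measurable => //.
  exact: within_continuousX2.
- by move=> x _; rewrite lee_fin sqr_ge0.
- apply/measurable_EFinP; apply: within_continuous_measurable => //.
  exact: within_continuousX2.
by rewrite /cdot opprD EFinD; apply: leeD.
Qed.

(** The energy identity summed over real and imaginary parts, where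
    [- V |u|^2 = |u|^p - lam |u|^2 <= |u|^p]. *)
Lemma bedge_gradient (b : bedge G) : 0 <= lam ->
  (\int[lebesgue_measure]_(x in edge_itv (inl b : edge G))
     (complex.Re (du (inl b) x) ^+ 2 + complex.Im (du (inl b) x) ^+ 2)%:E
   <= (\int[lebesgue_measure]_(x in `[0, elen b]) (Normc.normc (u (inl b) x) `^ p)
       + (cdot (u (inl b) (elen b)) (du (inl b) (elen b))
          - cdot (u (inl b) 0) (du (inl b) 0)))%:E)%E.
Proof.
move=> lam0; rewrite [edge_itv _]/=.
have [HR HI] := bedge_ode b.
have [cV cR cdR _ _] := HR; have [_ cI cdI _ _] := HI.
have l0 := ltW (elen_gt0 b).
have cN : {within `[0, elen b], continuous (fun x => Normc.normc (u (inl b) x) `^ p)}.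
  apply: within_continuous_powR; first exact: lt_trans p_gt2.
    by move=> x; exact: normc_ge0.
  exact: within_continuous_normc (@u_cont (inl b)).
have cdS : {within `[0, elen b], continuous (fun x =>
    complex.Re (du (inl b) x) ^+ 2 + complex.Im (du (inl b) x) ^+ 2)}.
  by apply: within_continuousD; exact: within_continuousX2.
have iS := continuous_itv_integrable cdS.
rewrite -(fineK (integrable_fin_num _ iS))// lee_fin -[leLHS]/(Rintegral _ _ _).
have cE (f g : R -> R) : {within `[0, elen b], continuous f} ->
    {within `[0, elen b], continuous g} ->
    {within `[0, elen b], continuous (fun x => g x ^+ 2 + potential (inl b) x * f x ^+ 2)}.
  move=> cf cg; apply: within_continuousD; first exact: within_continuousX2.
  by apply: within_continuousM => //; exact: within_continuousX2.
have cER := cE _ _ cR cdR; have cEI := cE _ _ cI cdI.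
have -> : cdot (u (inl b) (elen b)) (du (inl b) (elen b)) - cdot (u (inl b) 0) (du (inl b) 0) =
   \int[lebesgue_measure]_(x in `[0, elen b])
     (complex.Re (du (inl b) x) ^+ 2 + potential (inl b) x * complex.Re (u (inl b) x) ^+ 2) +
   \int[lebesgue_measure]_(x in `[0, elen b])
     (complex.Im (du (inl b) x) ^+ 2 + potential (inl b) x * complex.Im (u (inl b) x) ^+ 2).
  by rewrite (energy_identity l0 HR) (energy_identity l0 HI) /cdot; ring.
rewrite -RintegralD//; [|exact: continuous_itv_integrable..].
rewrite -RintegralD//; [|exact: continuous_itv_integrable|]; last first.
  by apply: continuous_itv_integrable; exact: within_continuousD.
apply: le_Rintegral => //.
- apply: continuous_itv_integrable; apply: within_continuousD => //.
  exact: within_continuousD.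
- move=> x _.
  have -> : Normc.normc (u (inl b) x) `^ p = Normc.normc (u (inl b) x) `^ (p - 2) *
     (complex.Re (u (inl b) x) ^+ 2 + complex.Im (u (inl b) x) ^+ 2).
    rewrite -normc_powR2 -powRD ?subrK//.
    by apply/implyP => /eqP p0; exfalso; move: p_gt2; lra.
  rewrite /potential /kappa mul1r.
  have := mulr_ge0 lam0 (addr_ge0 (sqr_ge0 (complex.Re (u (inl b) x))) (sqr_ge0 (complex.Im (u (inl b) x)))).
  by set A := _ `^ (p - 2); lra.
Qed.

(** The Gagliardo-Nirenberg inequalities speak of a weak derivative of [u]. The
    pointwise derivative [du] of the equation is one, so that the same function
    enters these inequalities and the energy estimate. *)
Lemma bound_state_H1 : 0 <= lam -> H1_with_derivative u du.
Proof.
move=> lam_ge0; have [w [_ uv _ _ _]] := u_H1.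
split => //.
- move=> e; have [cR cI] := edge_du_continuous e.
  split.
  + by apply: within_continuous_measurable => //; exact: measurable_edge_itv.
  + by apply: within_continuous_measurable => //; exact: measurable_edge_itv.
  + apply/edge_norm2_lty; case: e {cR cI} => [b|h].
      exact: le_lt_trans (bedge_gradient b lam_ge0) (ltry _).
    exact: le_lt_trans (halfline_gradient h lam_ge0) (ltry _).
- case=> [b|h].
    have [HR HI] := bedge_ode b.
    by split; apply: weak_derivative_segment; [exact: elen_gt0|exact: HR|exact: elen_gt0|exact: HI].
  split; apply: (weak_derivative_halfline (V := fun=> lam)) => M M0.
    exact: (halfline_ode h M0).1.
  exact: (halfline_ode h M0).2.
Qed.

Definition core_power : R :=
  \sum_(b : bedge G) \int[lebesgue_measure]_(x in `[0, elen b])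
    (Normc.normc (u (inl b) x) `^ p).

Lemma bedge_power_integrable (b : bedge G) :
  lebesgue_measure.-integrable `[0, elen b]
    (EFin \o (fun x => Normc.normc (u (inl b) x) `^ p)).
Proof.
apply: continuous_itv_integrable; apply: within_continuous_powR.
- exact: lt_trans p_gt2.
- by move=> x; exact: normc_ge0.
- exact: within_continuous_normc (@u_cont (inl b)).
Qed.

(** Sum of the estimates over all edges: by the Kirchhoff condition the boundary
    terms of the bounded edges cancel those of the half-lines. *)
Lemma gradient_le_core_power : 0 <= lam -> core_nonempty G ->
  (forall v : vertex G, in_core v -> kirchhoff_sum du v = 0) ->
  (\sum_(e : edge G) edge_norm 2%:E du e `^ 2 <= core_power%:E)%E.
Proof.
move=> lam_ge0 G_core K.
have [w [_ [uv [ub uh]] _ _ _]] := u_H1.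
have flux := kirchhoff_flux ub uh (fun v => K v (core_nonempty_in_core v G_core)).
rewrite big_sumType/=.
apply: (@le_trans _ _ ((\sum_(b : bedge G)
  (\int[lebesgue_measure]_(x in `[0, elen b]) (Normc.normc (u (inl b) x) `^ p)
   + (cdot (u (inl b) (elen b)) (du (inl b) (elen b))
          - cdot (u (inl b) 0) (du (inl b) 0))) +
  \sum_(h : halfline G) - cdot (u (inr h) 0) (du (inr h) 0))%:E)).
  rewrite [leRHS]EFinD -!sumEFin; apply: leeD.
    apply: lee_sum => i _; rewrite edge_norm2_sqr.
    exact: bedge_gradient i lam_ge0.
  apply: lee_sum => i _; rewrite edge_norm2_sqr.
  exact: halfline_gradient i lam_ge0.
by rewrite lee_fin big_split/= flux sumrN addrK.
Qed.

Lemma core_power_le_Lp :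
  (core_power%:E <= Lp_norm p u `^ p)%E.
Proof.
have p0 : p != 0 by rewrite gt_eqF// (lt_trans _ p_gt2).
rewrite Lp_norm_poweR// big_sumType/=.
rewrite -[leLHS]adde0; apply: leeD; last by apply: sume_ge0 => h _; exact: poweR_ge0.
rewrite /core_power -sumEFin; apply: lee_sum => b _.
by rewrite edge_norm_poweR// fineK// integrable_fin_num//; exact: bedge_power_integrable.
Qed.

Lemma core_power_le_Linfty (m : R) : 0 <= m -> (Linfty_norm u <= m%:E)%E ->
  core_power <= core_length G * m `^ p.
Proof.
move=> m0 um; rewrite /core_power /core_length mulr_suml; apply: ler_sum => b _.
have l0 := elen_gt0 b.
have <- : \int[lebesgue_measure]_(x in `[0, elen b]) (cst (m `^ p) x) = elen b * m `^ p.
  by rewrite Rintegral_cst_itv// subr0 mulrC.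
have iP := bedge_power_integrable b.
have iC : lebesgue_measure.-integrable `[0, elen b] (EFin \o (cst (m `^ p) : R -> R)).
  by apply: continuous_itv_integrable; exact: within_continuous_cst.
apply: fine_le.
- exact: integrable_fin_num.
- exact: integrable_fin_num.
apply: ae_ge0_le_integral => //.
- by move=> x _; rewrite lee_fin powR_ge0.
- by have /integrableP[] := iP.
- by move=> x _; rewrite lee_fin powR_ge0.
- by have /integrableP[] := iC.
have [N [mN N0 sN]] := edge_Linfty_ae u (inl b); exists N; split => //.
apply: subset_trans sN => x; apply: contra_not => h xb.
have := le_trans (h xb) (le_trans (le_edge_norm_Linfty u (inl b)) um).
rewrite !lee_fin => um'; apply: ge0_ler_powR => //.
- by apply: ltW; exact: lt_trans p_gt2.
- by rewrite nnegrE normc_ge0.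
Qed.

(** Excludes a vanishing gradient, by which the threshold argument divides. *)
Lemma Linfty_le0_mass0 : (Linfty_norm u <= 0)%E -> (Lp_norm 2 u `^ 2 = 0)%E.
Proof.
move=> u0; rewrite Lp_norm_poweR// big1// => e _; rewrite edge_norm_poweR//.
apply/eqP; rewrite eq_le; apply/andP; split; last first.
  by apply: integral_ge0 => x _; rewrite lee_fin powR_ge0.
have [mR mI _] := u_L2 e.
rewrite -(integral0 lebesgue_measure (edge_itv e)).
apply: ae_ge0_le_integral => //.
- exact: measurable_edge_itv.
- by move=> x _; rewrite lee_fin powR_ge0.
- apply/measurable_EFinP; under eq_fun do rewrite normc_powR2.
  by apply: measurable_funD; exact: measurable_funX.
have [N [mN N0 sN]] := edge_Linfty_ae u e; exists N; split => //.
apply: subset_trans sN => x; apply: contra_not => h xb.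
have := le_trans (h xb) (le_trans (le_edge_norm_Linfty u e) u0).
rewrite !lee_fin => um'.
have -> : Normc.normc (u e x) = 0 by apply/eqP; rewrite eq_le um' normc_ge0.
by rewrite powR0.
Qed.

End bound_state.

(** * The threshold *)

(** The three inequalities are linear in logarithms. With [d = |u'|^2], the second
    upper bound on [P] gives [1 <= l Ci^p mu^(p/4) d^((p-4)/4)], and the first one
    bounds [d] above by [(Cp mu^((p+2)/4))^(4/(6-p))]; as [p >= 4] these combine.
    On logarithms, the two bounds on [ln d] are added with weights [6 - p] (second)
    and [p - 4] (first), which makes [ln d] cancel. *)
Lemma mass_threshold (R : realType) (p mu Cp Ci l d P : R) :
  4 <= p -> p < 6 -> 0 < mu -> 0 < Cp -> 0 < Ci -> 0 < d -> d <= P ->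
  P <= Cp * (mu `^ 2^-1) `^ (p / 2 + 1) * (d `^ 2^-1) `^ (p / 2 - 1) ->
  P <= l * (Ci * (mu `^ 2^-1) `^ 2^-1 * (d `^ 2^-1) `^ 2^-1) `^ p ->
  Ci `^ (- p) * Cp `^ ((4 - p) / (6 - p)) <= l * mu `^ ((p - 2) / (6 - p)).
Proof.
move=> p4 p6.
have p60 : 0 < 6 - p by rewrite subr_gt0.
have p40 : 0 <= p - 4 by rewrite subr_ge0.
have p6n0 : 6 - p != 0 by rewrite gt_eqF.
move=> mu0 Cp0 Ci0 d0 dP P1 P2.
have lnMp (x y : R) : 0 < x -> 0 < y -> ln (x * y) = ln x + ln y.
  by move=> x0 y0; rewrite lnM ?posrE.
have a0 (x q : R) : 0 < x -> 0 < x `^ q by move=> x0; exact: powR_gt0.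
have lnPP (x q r : R) : ln ((x `^ q) `^ r) = r * (q * ln x) by rewrite !ln_powR.
have lnM3 (x q r : R) : 0 < x ->
    ln (x * (mu `^ 2^-1) `^ q * (d `^ 2^-1) `^ r) =
    ln x + q * (2^-1 * ln mu) + r * (2^-1 * ln d).
  move=> x0; rewrite !lnMp ?mulr_gt0 ?a0//.
  by congr (_ + _ + _); exact: lnPP.
have l0 : 0 < l.
  have := lt_le_trans (lt_le_trans d0 dP) P2.
  by rewrite pmulr_lgt0// a0 ?mulr_gt0 ?a0.
have h1 : ln d <= ln Cp + (p / 2 + 1) * (2^-1 * ln mu) + (p / 2 - 1) * (2^-1 * ln d).
  by rewrite -lnM3// ler_ln ?posrE ?mulr_gt0 ?a0//; exact: le_trans dP P1.
have h2 : ln d <= ln l + p * (ln Ci + 2^-1 * (2^-1 * ln mu) + 2^-1 * (2^-1 * ln d)).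
  rewrite -lnM3// -ln_powR -lnMp ?a0 ?mulr_gt0 ?a0//.
  rewrite ler_ln ?posrE ?mulr_gt0 ?a0 ?mulr_gt0 ?a0//.
  exact: le_trans dP P2.
rewrite -ler_ln ?posrE ?mulr_gt0 ?a0//.
rewrite !lnMp ?mulr_gt0 ?a0// !ln_powR.
move: (ln d) (ln Cp) (ln Ci) (ln mu) (ln l) h1 h2 => A B C E F h1 h2.
rewrite -(ler_pM2l p60).
have := ler_wpM2l p40 h1; have := ler_wpM2l (ltW p60) h2.
rewrite -subr_ge0 => H2; rewrite -subr_ge0 => H1; rewrite -subr_ge0.
suff -> : (6 - p) * (F + (p - 2) / (6 - p) * E) -
    (6 - p) * (- p * C + (4 - p) / (6 - p) * B) =
    ((6 - p) * (F + p * (C + 2^-1 * (2^-1 * E) + 2^-1 * (2^-1 * A))) - (6 - p) * A) +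
    ((p - 4) * (B + (p / 2 + 1) * (2^-1 * E) + (p / 2 - 1) * (2^-1 * A)) - (p - 4) * A).
  exact: addr_ge0.
by field.
Qed.

Theorem theorem3p2 (R : realType) (G : metric_graph R) (p mu Cp Cinfty : R)
    (G_noncompact : noncompact G) (G_core : core_nonempty G)
    (p_ge4 : 4 <= p) (p_lt6 : p < 6) (mu_gt0 : 0 < mu)
    (Cp_GN : GN_constant p Cp) (Cinfty_GN : GN_constant_infty Cinfty)
    (small : core_length G * mu `^ ((p - 2) / (6 - p))
               < Cinfty `^ (- p) * Cp `^ ((4 - p) / (6 - p))) :
  (~ exists (u : graph_fun G) (lambda : R),
       0 <= lambda /\ bound_state_with_multiplier p mu lambda u) /\
  (~ exists u : graph_fun G, bound_state p mu u /\ supported_on_graph u).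
Proof.
have p_gt2 : 2 < p by lra.
have none (u : graph_fun G) (lam : R) : 0 <= lam ->
    ~ bound_state_with_multiplier p mu lam u.
  move=> lam0 [[uH1 umass] [du [uder ueq K]]].
  have H := bound_state_H1 p_gt2 uH1 uder ueq lam0.
  have DP := gradient_le_core_power p_gt2 uH1 uder ueq lam0 G_core K.
  have PL := core_power_le_Lp p_gt2 uH1.
  have [Cp0 /(_ G u du G_noncompact H) GNp] := Cp_GN.
  have [Ci0 /(_ G u du G_noncompact H) GNi] := Cinfty_GN.
  set D := (\sum_(e : edge G) edge_norm 2%:E du e `^ 2)%E in DP.
  have D0 : (0 <= D)%E by apply: sume_ge0 => e _; exact: poweR_ge0.
  have Df : D \is a fin_num by rewrite ge0_fin_numE// (le_lt_trans DP)// ltry.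
  have [d Dd] : exists d, D = d%:E by exists (fine D); rewrite fineK.
  have du2 : Lp_norm 2 du = (d `^ 2^-1)%:E.
    by rewrite /Lp_norm -/D Dd poweR_EFin.
  have u2 : Lp_norm 2 u = (mu `^ 2^-1)%:E.
    by rewrite -poweR_EFin -umass -poweRrM mulfV// poweRe1// poweR_ge0.
  rewrite u2 du2 !poweR_EFin -!EFinM in GNp GNi.
  rewrite Dd lee_fin in D0; rewrite Dd lee_fin in DP.
  have P1 := le_trans PL GNp; rewrite lee_fin in P1.
  have m0 : 0 <= Cinfty * (mu `^ 2^-1) `^ 2^-1 * (d `^ 2^-1) `^ 2^-1.
    by rewrite !mulr_ge0 ?powR_ge0// ltW.
  have P2 := core_power_le_Linfty p_gt2 uH1 m0 GNi.
  move: D0; rewrite le_eqVlt => /predU1P[d0|d0]; last first.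
    have := mass_threshold p_ge4 p_lt6 mu_gt0 Cp0 Ci0 d0 DP P1 P2.
    by rewrite leNgt small.
  have := Linfty_le0_mass0 uH1; rewrite umass => h.
  have [mu0] : mu%:E = 0%E :> \bar R.
    apply: h; rewrite (le_trans GNi)// lee_fin -d0.
    by rewrite [0 `^ 2^-1]powR0// [0 `^ 2^-1]powR0// mulr0.
  by move: mu_gt0; rewrite mu0 ltxx.
split; first by move=> [u [lam [lam0 /(none u lam lam0)]]].
move=> [u [[lam ub] usupp]].
have [lam0|lam0] := leP 0 lam; first exact: none ub.
apply: usupp; have [[uH1 umass] [du [uder ueq K]]] := ub.
exact: (negative_multiplier_supported_on_core p_gt2 uH1 uder ueq lam0).
Qed.
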